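(* Let $G$ be a locally compact abelian group with dual group $\widehat{G}$. If a linear and bounded operator $T : L^1(G)\to C^b(\widehat{G})$ satisfies (i) the time shift property, i.e., for every $f\in L^1(G)$, $x\in G$ and $\chi\in\widehat{G}$ we have $T(L_x f)(\chi) = \overline{\chi(x)}\, T(f)(\chi)$, and (ii) the Dirac delta property, i.e., there exists a Dirac delta family $(\delta_U)_{U\in N_0}$ such that for every $\chi\in\widehat{G}$ the limit of $T(\delta_U)(\chi)$ as $U$ shrinks to the neutral element is $1$; explicitly, for every $\chi\in\widehat{G}$ and every $\varepsilon>0$ there exists $U\in N_0$ such that $|T(\delta_V)(\chi)-1|<\varepsilon$ for every $V\in N_0$ with $V\subset U$, then $T$ is the Fourier transform, i.e. $$T(f)(\chi) = \int_G f(x)\overline{\chi(x)}\,dx$$ for every $f\in L^1(G)$ and $\chi\in\widehat{G}$.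
   Context: $G$ is written additively; $dx$ denotes a fixed Haar measure on $G$, and $L^1(G)$ is the Banach space of complex-valued functions integrable with respect to it. $\widehat{G}$ is the group of continuous characters $\chi : G\to\{z\in\mathbb{C}:|z|=1\}$ with its usual topology, and $C^b(\widehat{G})$ is the Banach space of complex-valued, continuous, bounded functions on $\widehat{G}$ with the supremum norm. For $x\in G$ the shift operator $L_x : L^1(G)\to L^1(G)$ is given by $L_xf(t) := f(t-x)$. $N_0$ denotes the set of all open, nonempty neighbourhoods of the neutral element of $G$. A family $(\delta_U)_{U\in N_0}$ is called a Dirac delta family if every $\delta_U$ is continuous and compactly supported, i.e., $\delta_U\in C_c(G)$, is nonnegative and symmetric, i.e., $\delta_U(x)=\delta_U(-x)$ for every $x\in G$, and satisfies $\int_G\delta_U(x)\,dx=1$.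
   Formalization: The functions of a Dirac delta family are additionally required to satisfy supp δ_U ⊂ U; without this the claim is false (G = Z/2, δ_U = g = (3/4, 1/4) for all U, T f = f̂/ĝ). *)

(* Defs.v *)
From HB Require Import structures.
From mathcomp Require Import all_boot all_order all_algebra.
From mathcomp Require Import all_classical all_reals all_analysis.
From mathcomp Require Import measurable_realfun complex ring_quotient.

Set Implicit Arguments.
Unset Strict Implicit.
Unset Printing Implicit Defensive.
Import Order.TTheory GRing.Theory Num.Theory.
Import numFieldNormedType.Exports.
Local Open Scope classical_set_scope.
Local Open Scope ring_scope.
Local Open Scope complex_scope.

(* [R[i]] with the topology and the normed module structure over itself given by
   the complex modulus. *)
HB.instance Definition _ (R : realType) := NormedModule.copy R[i] R[i]^o.

Section ComplexFacts.
Variable R : realType.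
Implicit Types z w : R[i].

Lemma normCE z : `|z| = (complex.Re `|z|)%:C.
Proof. by case: z. Qed.

Lemma Re_normD z w :
  complex.Re `|z + w| <= complex.Re `|z| + complex.Re `|w|.
Proof. by have := ler_normD z w; rewrite (normCE z) (normCE w) (normCE (z + w)) -rmorphD lecR. Qed.

Lemma Re_normM z w :
  complex.Re `|z * w| = complex.Re `|z| * complex.Re `|w|.
Proof. by rewrite normrM (normCE z) (normCE w) -rmorphM. Qed.

Lemma Re_norm_ge0 z : 0 <= complex.Re `|z|.
Proof. by have := normr_ge0 z; rewrite normCE lecR. Qed.

Lemma Re_norm_eq0 z : complex.Re `|z| = 0 -> z = 0.
Proof. by move=> z0; apply/eqP; rewrite -normr_eq0 normCE z0. Qed.

Lemma Re_norm_le z : complex.Re `|z| <= `|complex.Re z| + `|complex.Im z|.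
Proof.
case: z => a b /=.
rewrite -[leRHS]ger0_norm ?addr_ge0// -sqrtr_sqr ler_wsqrtr//.
rewrite -(real_normK (num_real a)) -(real_normK (num_real b)) sqrrD.
by rewrite lerD2r lerDl mulrn_wge0// mulr_ge0.
Qed.

Let lip_continuous (h : R[i] -> R) :
  (forall z w, `|h z - h w| <= complex.Re `|z - w|) -> continuous h.
Proof.
move=> hlip z; apply/(@cvgrPdist_lt _ _ _ (nbhs z) (nbhs_filter z)) => e e0.
have e0' : 0 < e%:C :> R[i] by rewrite ltcR.
have : \forall w \near z, `|z - w| < e%:C by exact: (@cvgr_dist_lt _ _ _ (nbhs z) (nbhs_filter z) id z cvg_id _ e0').
apply: filterS => w zw; apply: le_lt_trans (hlip z w) _.
by rewrite -ltcR -normCE.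
Qed.

Lemma Re_continuous : continuous (@complex.Re R).
Proof.
apply: lip_continuous => -[a b] [c e] /=.
by rewrite -[leLHS]sqrtr_sqr ler_wsqrtr// lerDl sqr_ge0.
Qed.

Lemma Im_continuous : continuous (@complex.Im R).
Proof.
apply: lip_continuous => -[a b] [c e] /=.
by rewrite -[leLHS]sqrtr_sqr ler_wsqrtr// lerDr sqr_ge0.
Qed.

End ComplexFacts.

Section L1.
Context d (T : measurableType d) (R : realType).
Variable mu : {measure set T -> \bar R}.

Definition cintegrable (f : T -> R[i]) : Prop :=
  mu.-integrable setT (EFin \o (fun x => complex.Re (f x))) /\
  mu.-integrable setT (EFin \o (fun x => complex.Im (f x))).

Definition cintegral (f : T -> R[i]) : R[i] :=
  Rintegral mu setT (fun x => complex.Re (f x)) +i*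
  Rintegral mu setT (fun x => complex.Im (f x)).

Definition L1fun : {pred T -> R[i]} := [pred f | `[< cintegrable f >]].

Lemma L1funP f : reflect (cintegrable f) (f \in L1fun).
Proof. exact: asboolP. Qed.

Let integrable_lin (a b : R) (f g h : T -> R) :
  mu.-integrable setT (EFin \o f) -> mu.-integrable setT (EFin \o g) ->
  mu.-integrable setT (EFin \o h) ->
  mu.-integrable setT (EFin \o (fun x => a * f x + b * g x + h x)).
Proof.
move=> fi gi hi; apply: (@integrableD _ _ _ mu setT _
  (EFin \o (fun x => a * f x + b * g x)) (EFin \o h)) => //.
apply: (@integrableD _ _ _ mu setT _
  (EFin \o (fun x => a * f x)) (EFin \o (fun x => b * g x))) => //.
  exact: (integrableZl measurableT _ fi).
exact: (integrableZl measurableT _ gi).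
Qed.

Lemma L1fun_submod_closed : submod_closed L1fun.
Proof.
split; first by apply/L1funP; split; exact: integrable0.
move=> a f g /L1funP[f1 f2] /L1funP[g1 g2]; apply/L1funP; split.
- rewrite (_ : _ \o _ = EFin \o (fun x => complex.Re a * complex.Re (f x) +
    - complex.Im a * complex.Im (f x) + complex.Re (g x))).
    exact: integrable_lin.
  apply/funext => x /=; rewrite !fctE mulNr.
  by case: a (f x) (g x) => ? ? [? ?] [? ?].
- rewrite (_ : _ \o _ = EFin \o (fun x => complex.Re a * complex.Im (f x) +
    complex.Im a * complex.Re (f x) + complex.Im (g x))).
    exact: integrable_lin.
  apply/funext => x /=; rewrite !fctE.
  by case: a (f x) (g x) => ? ? [? ?] [? ?].
Qed.

HB.instance Definition _ :=
  GRing.isSubmodClosed.Build _ _ L1fun L1fun_submod_closed.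

(* Functions, as opposed to the classes modulo a.e. equality in [L1] below. *)
Record integrable_fun := IntegrableFun {
  integrable_val :> T -> R[i];
  integrable_valP : integrable_val \in L1fun }.

HB.instance Definition _ := [isSub for integrable_val].
HB.instance Definition _ := [Choice of integrable_fun by <:].
HB.instance Definition _ := [SubChoice_isSubLmodule of integrable_fun by <:].

Definition null_fun : {pred integrable_fun} :=
  [pred f : integrable_fun | `[< {ae mu, forall x, f x = 0} >]].

Lemma null_funP (f : integrable_fun) :
  reflect {ae mu, forall x, f x = 0} (f \in null_fun).
Proof. exact: asboolP. Qed.

Lemma null_fun_submod_closed : submod_closed null_fun.
Proof.
split; first by apply/null_funP; exact: aeW.
move=> a f g /null_funP f0 /null_funP g0; apply/null_funP.
near=> x; rewrite /= !fctE.
have -> : f x = 0 by near: x.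
have -> : g x = 0 by near: x.
by rewrite scaler0 addr0.
Unshelve. all: by end_near. Qed.

HB.instance Definition _ :=
  GRing.isSubmodClosed.Build _ _ null_fun null_fun_submod_closed.

Definition L1 : Type := Quotient.quot null_fun.

HB.instance Definition _ := GRing.Zmodule.on L1.
HB.instance Definition _ := EqQuotient.on L1.

Definition L1repr (f : L1) : T -> R[i] := integrable_val (repr f).
Coercion L1repr : L1 >-> Funclass.

(* The class of [f], with junk value 0 if [f] is not integrable. *)
Definition toL1 (f : T -> R[i]) : L1 := \pi%qT (insubd (0 : integrable_fun) f).

Lemma L1_piE (f g : integrable_fun) :
  \pi_L1%qT f = \pi_L1%qT g <-> {ae mu, forall x, f x = g x}.
Proof.
split.
  move/eqP; rewrite -Quotient.idealrBE => /null_funP.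
  by apply: filterS => x /=; rewrite !fctE => /subr0_eq.
move=> fg; apply/eqP; rewrite -Quotient.idealrBE; apply/null_funP.
by apply: filterS fg => x /= xE; rewrite !fctE xE subrr.
Qed.

Lemma L1_reprP (f : integrable_fun) :
  {ae mu, forall x, (\pi_L1%qT f : L1) x = f x}.
Proof. by apply/L1_piE; rewrite reprK. Qed.

Lemma L1P (f g : L1) : f = g <-> {ae mu, forall x, f x = g x}.
Proof.
split=> [->|fg]; first exact: aeW.
by rewrite -(reprK f) -(reprK g); exact/L1_piE.
Qed.

Lemma L1_cintegrable (f : L1) : cintegrable f.
Proof. exact/L1funP/integrable_valP. Qed.

Lemma toL1P (f : T -> R[i]) : cintegrable f ->
  {ae mu, forall x, toL1 f x = f x}.
Proof.
move=> /L1funP fi; have := L1_reprP (insubd (0 : integrable_fun) f).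
by apply: filterS => x ->; rewrite -[integrable_val _]/(val _) insubdK.
Qed.

Definition L1scale (a : R[i]) (f : L1) : L1 := \pi%qT (a *: repr f).

Lemma pi_scale a (f : integrable_fun) :
  \pi_L1%qT (a *: f) = L1scale a (\pi_L1%qT f).
Proof.
apply/L1_piE; have := L1_reprP f; apply: filterS => x.
by rewrite /L1repr /= !fctE => ->.
Qed.

Lemma L1scaleA a b f : L1scale a (L1scale b f) = L1scale (a * b) f.
Proof.
rewrite -[f]reprK; move: (repr f) => {}f.
by rewrite -(pi_scale b f) -(pi_scale a (b *: f)) -(pi_scale (a * b) f) scalerA.
Qed.

Lemma L1scale1 : left_id 1 L1scale.
Proof.
by move=> f; rewrite -[f]reprK; move: (repr f) => {}f; rewrite -(pi_scale 1 f) scale1r.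
Qed.

Lemma L1scaleDr : right_distributive L1scale +%R.
Proof.
move=> a f g; rewrite -[f]reprK -[g]reprK.
move: (repr f) (repr g) => {}f {}g.
by rewrite -raddfD -(pi_scale a f) -(pi_scale a g) -(pi_scale a (f + g)) -raddfD scalerDr.
Qed.

Lemma L1scaleDl f : {morph L1scale^~ f : a b / a + b}.
Proof.
move=> a b /=; rewrite -[f]reprK; move: (repr f) => {}f.
by rewrite -(pi_scale a f) -(pi_scale b f) -(pi_scale (a + b) f) -raddfD scalerDl.
Qed.

HB.instance Definition _ := GRing.Zmodule_isLmodule.Build R[i] L1
  L1scaleA L1scale1 L1scaleDr L1scaleDl.

Let Rnorm (f : T -> R[i]) (x : T) : R := complex.Re `|f x|.

Lemma cintegrable_norm f : cintegrable f -> mu.-integrable setT (EFin \o Rnorm f).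
Proof.
move=> [f1 f2].
have mf1 : measurable_fun setT (fun x => complex.Re (f x)).
  by apply/measurable_EFinP; exact: measurable_int f1.
have mf2 : measurable_fun setT (fun x => complex.Im (f x)).
  by apply/measurable_EFinP; exact: measurable_int f2.
apply: (@le_integrable _ _ _ mu setT measurableT _ (EFin \o
   (fun x => `|complex.Re (f x)| + `|complex.Im (f x)|))).
- apply/measurable_EFinP.
  rewrite (_ : Rnorm f = Num.sqrt \o
      (fun x => complex.Re (f x) ^+ 2 + complex.Im (f x) ^+ 2)); last first.
    by apply/funext => x; rewrite /Rnorm /=; case: (f x).
  apply: measurableT_comp.
    by apply: continuous_measurable_fun; exact: sqrt_continuous.
  by apply: measurable_funD; exact: measurable_funX.
- move=> x _ /=; rewrite lee_fin ger0_norm ?Re_norm_ge0//.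
  by rewrite ger0_norm ?addr_ge0//; exact: Re_norm_le.
- apply: (@integrableD _ _ _ mu setT _ (EFin \o (fun x => `|complex.Re (f x)|))
    (EFin \o (fun x => `|complex.Im (f x)|))) => //; exact: integrable_norm.
Qed.

Let ae_Rintegral (f g : T -> R) : mu.-integrable setT (EFin \o f) ->
  mu.-integrable setT (EFin \o g) -> {ae mu, forall x, f x = g x} ->
  Rintegral mu setT f = Rintegral mu setT g.
Proof.
move=> fi gi fg; rewrite /Rintegral; congr fine; apply: ae_eq_integral => //.
- exact: measurable_int fi.
- exact: measurable_int gi.
- by apply: filterS fg => x /= ->.
Qed.

Lemma L1_addE (f g : L1) : {ae mu, forall x, (f + g : L1) x = f x + g x}.
Proof.
have -> : f + g = \pi_L1%qT (repr f + repr g) by rewrite raddfD /= !reprK.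
by have := L1_reprP (repr f + repr g); apply: filterS => x ->.
Qed.

Lemma L1_scaleE a (f : L1) : {ae mu, forall x, (a *: f : L1) x = a * f x}.
Proof. by have := L1_reprP (a *: repr f); apply: filterS => x ->. Qed.

Definition L1norm (f : L1) : R[i] := (Rintegral mu setT (Rnorm f))%:C.

Lemma L1normE (f : L1) (g : T -> R[i]) : cintegrable g ->
  {ae mu, forall x, f x = g x} -> L1norm f = (Rintegral mu setT (Rnorm g))%:C.
Proof.
move=> gi fg; congr (_%:C); apply: ae_Rintegral.
- exact/cintegrable_norm/L1_cintegrable.
- exact: cintegrable_norm.
- by apply: filterS fg => x; rewrite /Rnorm => ->.
Qed.

Lemma L1_ler_normD (f g : L1) : L1norm (f + g) <= L1norm f + L1norm g.
Proof.
have fgi : cintegrable ((f : T -> R[i]) \+ g).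
  by apply/L1funP/rpredD; exact: integrable_valP.
have fi := cintegrable_norm (L1_cintegrable f).
have gi := cintegrable_norm (L1_cintegrable g).
rewrite (L1normE fgi (L1_addE f g)) -rmorphD lecR -RintegralD//.
apply: le_Rintegral => //; first exact: cintegrable_norm.
- exact: (@integrableD _ _ _ mu setT _ (EFin \o Rnorm f) (EFin \o Rnorm g)).
- by move=> x _; exact: Re_normD.
Qed.

Lemma L1_normrZ (a : R[i]) (f : L1) : L1norm (a *: f) = `|a| * L1norm f.
Proof.
have afi : cintegrable (fun x => a * f x).
  by apply/L1funP/(@rpredZ _ _ L1fun a (L1repr f)); exact: integrable_valP.
have fi := cintegrable_norm (L1_cintegrable f).
rewrite (L1normE afi (L1_scaleE a f)) normCE -rmorphM -RintegralZl//.
by congr (_%:C); apply: eq_Rintegral => x _; rewrite /Rnorm Re_normM.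
Qed.

Lemma L1_normr0_eq0 (f : L1) : L1norm f = 0 -> f = 0.
Proof.
have fi := cintegrable_norm (L1_cintegrable f).
move=> /(congr1 (@complex.Re R)) /= f0; apply/L1P.
have : (\int[mu]_x `|(EFin \o Rnorm f) x|)%E = 0%E.
  rewrite (eq_integral (EFin \o Rnorm f)); last first.
    by move=> x _ /=; rewrite ger0_norm ?Re_norm_ge0.
  by rewrite -[LHS]fineK ?integrable_fin_num//; congr EFin.
move=> /(ae_eq_integral_abs mu measurableT (measurable_int mu fi)) f0'.
have := L1_reprP 0; rewrite raddf0; apply: filterS2 f0' => x /= + ->.
by move=> /(_ I) [] /Re_norm_eq0.
Qed.

HB.instance Definition _ := Lmodule_isNormed.Build R[i] L1
  L1_ler_normD L1_normrZ L1_normr0_eq0.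

End L1.

Section Cb.
Variables (X : topologicalType) (R : realType).

Definition Cbfun : {pred X -> R[i]} :=
  [pred f | `[< continuous f /\ exists M : R, forall x, `|f x| <= M%:C >]].

Lemma CbfunP f : reflect
  (continuous f /\ exists M : R, forall x, `|f x| <= M%:C) (f \in Cbfun).
Proof. exact: asboolP. Qed.

Lemma Cbfun_submod_closed : submod_closed Cbfun.
Proof.
split.
  by apply/CbfunP; split; [exact: cst_continuous|exists 0 => x; rewrite normr0].
move=> a f g /CbfunP[cf [M fM]] /CbfunP[cg [N gN]]; apply/CbfunP; split.
  by move=> x; apply: cvgD; [apply: cvgZr; exact: cf|exact: cg].
exists (complex.Re `|a| * M + N) => x; rewrite rmorphD rmorphM /= -normCE.
by rewrite (le_trans (ler_normD _ _))// lerD// normrM ler_wpM2l.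
Qed.

HB.instance Definition _ :=
  GRing.isSubmodClosed.Build _ _ Cbfun Cbfun_submod_closed.

Record Cb := MkCb { Cb_val :> X -> R[i]; Cb_valP : Cb_val \in Cbfun }.

HB.instance Definition _ := [isSub for Cb_val].
HB.instance Definition _ := [Choice of Cb by <:].
HB.instance Definition _ := [SubChoice_isSubLmodule of Cb by <:].

Definition Cbnorm (f : Cb) : R[i] :=
  (sup [set complex.Re `|f x| | x in [set: X]])%:C.

Lemma Cbnorm_ub (f : Cb) x : `|f x| <= Cbnorm f.
Proof.
rewrite normCE lecR; apply: ub_le_sup; last by exists x.
have /CbfunP[_ [M fM]] := Cb_valP f; exists M => _ [y _ <-].
by rewrite -lecR -normCE.
Qed.

Lemma Cbnorm_le (f : Cb) (M : R) : 0 <= M -> (forall x, `|f x| <= M%:C) ->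
  Cbnorm f <= M%:C.
Proof.
move=> M0 fM; rewrite lecR.
have [->|/set0P S0] := eqVneq [set complex.Re `|f x| | x in [set: X]] set0.
  by rewrite sup0.
by apply: ge_sup => // _ [x _ <-]; rewrite -lecR -normCE.
Qed.

Lemma Cbnorm_ge0 (f : Cb) : 0 <= sup [set complex.Re `|f x| | x in [set: X]].
Proof.
have [->|/set0P [_ [x _ _]]] :=
  eqVneq [set complex.Re `|f x| | x in [set: X]] set0; first by rewrite sup0.
by rewrite -lecR; apply: le_trans (Cbnorm_ub f x); exact: normr_ge0.
Qed.

Lemma Cb_ler_normD f g : Cbnorm (f + g) <= Cbnorm f + Cbnorm g.
Proof.
rewrite -rmorphD; apply: Cbnorm_le => [|x]; first by rewrite addr_ge0 ?Cbnorm_ge0.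
by rewrite rmorphD (le_trans (ler_normD _ _))// lerD// Cbnorm_ub.
Qed.

Lemma Cb_normrZ (a : R[i]) f : Cbnorm (a *: f) = `|a| * Cbnorm f.
Proof.
have le_normZ b g : Cbnorm (b *: g) <= `|b| * Cbnorm g.
  rewrite [X in X * _]normCE -rmorphM; apply: Cbnorm_le => [|x].
    by rewrite mulr_ge0 ?Cbnorm_ge0 ?Re_norm_ge0.
  by rewrite rmorphM /= -normCE normrM ler_wpM2l// Cbnorm_ub.
apply/eqP; rewrite eq_le le_normZ /=.
have [->|a0] := eqVneq a 0.
  by rewrite normr0 mul0r lecR Cbnorm_ge0.
rewrite -{1}(scalerK a0 f).
rewrite (le_trans (ler_wpM2l (normr_ge0 a) (le_normZ _ _)))//.
by rewrite normfV mulVKf ?normr_eq0.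
Qed.

Lemma Cb_normr0_eq0 f : Cbnorm f = 0 -> f = 0.
Proof.
move=> f0; apply/val_inj/funext => x; apply/eqP.
by rewrite -normr_eq0 eq_le normr_ge0 andbT -f0 Cbnorm_ub.
Qed.

HB.instance Definition _ := Lmodule_isNormed.Build R[i] Cb
  Cb_ler_normD Cb_normrZ Cb_normr0_eq0.

End Cb.

Record dual (G : topologicalZmodType) (R : realType) := Character {
  char_val :> G -> R[i];
  char_continuous : continuous char_val;
  charD : forall x y, char_val (x + y) = char_val x * char_val y;
  char_norm : forall x, `|char_val x| = 1 }.

HB.instance Definition _ (G : topologicalZmodType) (R : realType) :=
  gen_eqMixin (dual G R).
HB.instance Definition _ (G : topologicalZmodType) (R : realType) :=
  gen_choiceMixin (dual G R).
HB.instance Definition _ (G : topologicalZmodType) (R : realType) :=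
  Topological.copy (dual G R)
    (@initial_topology (dual G R) {compact-open, G -> R[i]}
      (@char_val G R)).

Definition borel (G : topologicalZmodType) : Type := G.

HB.instance Definition _ (G : topologicalZmodType) := Choice.on (borel G).
HB.instance Definition _ (G : topologicalZmodType) := isPointed.Build (borel G) 0.
HB.instance Definition _ (G : topologicalZmodType) :=
  Measurable.copy (borel G)
    (g_sigma_algebraType (@open G : set (set (borel G)))).


(* Haar measure as a Radon measure: Borel, finite on compact sets, outer regular
   on Borel sets and inner regular on open sets. *)
Record haar_measure (G : topologicalZmodType) (R : realType)
    (mu : {measure set (borel G) -> \bar R}) : Prop := HaarMeasure {
  haar_neq0 : mu [set: G] <> 0%E;
  haar_compact : forall K : set G, compact K -> (mu K < +oo)%E;
  haar_shift : forall (x : G) (A : set (borel G)), measurable A ->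
    mu [set x + y | y in (A : set G)] = mu A;
  haar_outer : forall A : set (borel G), measurable A ->
    mu A = ereal_inf [set mu U | U in [set U : set G | open U /\ A `<=` U]];
  haar_inner : forall U : set G, open U ->
    mu U = ereal_sup [set mu K | K in [set K : set G | compact K /\ K `<=` U]] }.

Section InvariantIntegrable.
Context d (T : measurableType d) (R : realType).
Variables (mu : {measure set T -> \bar R}) (phi : T -> T).
Hypothesis mphi : measurable_fun setT phi.
Hypothesis phi_mu : forall A, measurable A -> mu (phi @^-1` A) = mu A.

Let phi_mfun : {mfun T >-> T} :=
  HB.pack phi (isMeasurableFun.Build _ _ _ _ _ mphi).

Lemma invariant_integrable (g : T -> R) :
  mu.-integrable setT (EFin \o g) ->
  mu.-integrable setT (EFin \o (g \o phi)).
Proof.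
move=> /integrableP[mg goo]; apply/integrableP; split.
  exact: (measurableT_comp mg mphi).
apply: le_lt_trans goo.
rewrite -(@ge0_integral_pushforward _ _ _ _ _ _ mphi mu setT
  (fun x => `|(EFin \o g) x|)%E)//; last exact: measurableT_comp.
rewrite (@eq_measure_integral _ _ _ setT mu (pushforward mu phi_mfun))//.
by move=> A mA _; exact: phi_mu.
Qed.

End InvariantIntegrable.

Section Group.
Variables (G : topologicalZmodType) (R : realType).
Variable mu : {measure set (borel G) -> \bar R}.

(* By [shift_cintegrable] below, the argument of [toL1] is integrable. *)
Definition Lshift (x : G) (f : L1 mu) : L1 mu :=
  toL1 mu (fun t : G => f (t - x)).

Definition csupport (f : G -> R[i]) : set G := closure [set x | f x != 0].

(* [0 <= g x] in [R[i]] says that [g x] is a nonnegative real. Through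
   [dirac_support], the functions of a Dirac family concentrate at 0. *)
Record dirac_function (U : set G) (g : G -> R[i]) : Prop := DiracFunction {
  dirac_continuous : continuous g;
  dirac_compact : compact (csupport g);
  dirac_support : csupport g `<=` U;
  dirac_ge0 : forall x, 0 <= g x;
  dirac_sym : forall x, g (- x) = g x;
  dirac_integral : cintegral mu g = 1 }.

Definition dirac_family (delta : set G -> G -> R[i]) : Prop :=
  forall U : set G, open_nbhs 0 U -> dirac_function U (delta U).

Hypothesis haar_mu : haar_measure mu.

Lemma shift_measurable (x : G) :
  measurable_fun setT ((fun t => t - x) : borel G -> borel G).
Proof.
apply: (@measurability _ _ (borel G) (borel G) setT _ (@open G) erefl).
move=> _ [U oU <-]; rewrite setTI; apply: sub_sigma_algebra.
apply: open_comp => // y _.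
exact: (@continuous_comp _ _ _ (fun y => (y, x)) (fun z : G * G => z.1 - z.2) y
  (cvg_pair cvg_id (cvg_cst _)) (@sub_continuous G (y, x))).
Qed.

Lemma shift_cintegrable (x : G) (f : G -> R[i]) : cintegrable mu f ->
  cintegrable mu (fun t : G => f (t - x)).
Proof.
have mux (A : set (borel G)) : measurable A ->
    mu (((fun t => t - x) : borel G -> borel G) @^-1` A) = mu A.
  move=> mA; rewrite -(haar_shift haar_mu x mA); congr (mu _).
  apply/seteqP; split=> [y /= Ay|_ [y Ay <-]] /=; last by rewrite addrC addKr.
  by exists (y - x) => //; rewrite addrC subrK.
move=> [f1 f2]; split.
- exact: (invariant_integrable (shift_measurable x) mux f1).
- exact: (invariant_integrable (shift_measurable x) mux f2).
Qed.

Lemma LshiftE (x : G) (f : L1 mu) :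
  {ae mu, forall t : borel G, Lshift x f t = f ((t : G) - x)}.
Proof. exact/toL1P/shift_cintegrable/L1_cintegrable. Qed.

(* Hence [toL1 mu g] is the class of [g] for every Dirac function [g]. *)
Lemma Cc_cintegrable (f : G -> R[i]) :
  continuous f -> compact (csupport f) -> cintegrable mu f.
Proof.
move=> cf cK; pose K : set (borel G) := csupport f.
have mK : measurable K.
  rewrite -[K]setCK; apply: measurableC; apply: sub_sigma_algebra.
  exact/closed_openC/closed_closure.
have muK : (mu K < +oo)%E by exact: (haar_compact haar_mu).
have H (h : R[i] -> R) : continuous h -> h 0 = 0 ->
    mu.-integrable setT (EFin \o ((h \o f) : borel G -> R)).
  move=> ch h0.
  have chf : continuous (h \o f).
    by move=> x; apply: continuous_comp; [exact: cf|exact: ch].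
  have mhf : measurable_fun setT ((h \o f) : borel G -> R).
    apply: (@measurability _ _ (borel G) _ setT _ _ (RGenOpens.measurableE R)).
    move=> _ [_ [a [b ->] <-]]; rewrite setTI; apply: sub_sigma_algebra.
    by move/continuousP : chf; apply; exact: interval_open.
  rewrite (_ : EFin \o _ = (EFin \o ((h \o f) : borel G -> R)) \_ K); last first.
    apply/funext => x; rewrite patchE; case: ifPn => // /negP xK /=.
    have -> : f x = 0; last by rewrite h0.
    apply/eqP/negPn/negP => fx0; apply: xK.
    by apply/mem_set/subset_closure.
  apply/(integrable_mkcond _ mK).
  apply: (@measurable_bounded_integrable _ _ _ mu ((h \o f) : borel G -> R)) => //.
    exact: measurable_funTS.
  have := @compact_bounded R R^o ((h \o f) @` K) (continuous_compact
    (continuous_subspaceT chf) cK).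
  move=> [M [Mr MP]]; exists M; split => // N MN x Kx.
  by apply: (MP N MN); exists x.
by split; apply: H => //; [exact: Re_continuous|exact: Im_continuous].
Qed.

End Group.

(* Main.v *)
(* Fix [chi]. On real integrable functions, the modulus of the difference
   between [T] and the Fourier transform at [chi] is a seminorm [p] that is
   dominated by the L^1 norm, does not increase under translations, and is small
   on some Dirac function [d] supported in any given neighbourhood of 0. Such a
   seminorm vanishes. Let [K] be compact and put [K' = K + supp d]. The function
   [t |-> \int_K' d (y - t) dy] has values in [0, 1], is 1 on [K] and 0 outside
   [K' + supp d], hence is L^1-close to the indicator of [K] by outer regularity.
   As [d] is even, its Riemann sums are nonnegative combinations of the
   translates [d (t - x)], with total weight [mu K'], so that [p] is at most
   [mu K' * p d] on them. Evenness thus makes translation invariance alone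
   suffice: neither Fubini's theorem nor the invariance of [mu] under [x |-> - x]
   is used. Regularity of [mu] and density of simple functions give the rest. *)

Require Import Defs.
From HB Require Import structures.
From mathcomp Require Import all_boot all_order all_algebra.
From mathcomp Require Import all_classical all_reals all_analysis.
From mathcomp Require Import measurable_realfun complex ring.

Set Implicit Arguments.
Unset Strict Implicit.
Unset Printing Implicit Defensive.
Import Order.TTheory GRing.Theory Num.Theory.
Import numFieldNormedType.Exports.
Local Open Scope classical_set_scope.
Local Open Scope ring_scope.
Local Open Scope complex_scope.

(** * Seminorms dominated by the L^1 norm *)

Section L1Seminorm.
Import HBSimple.
Context d (T : measurableType d) (R : realType).
Variable mu : {measure set T -> \bar R}.
Implicit Types (f g : T -> R) (A : set T).

Lemma integrable_indic_fin A : measurable A -> (mu A < +oo)%E ->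
  mu.-integrable setT (EFin \o \1_A).
Proof.
move=> mA Aoo; apply/integrableP; split.
  exact/measurable_EFinP/measurable_indic.
rewrite (eq_integral (fun x => (\1_A x)%:E)); last first.
  by move=> t _; rewrite gee0_abs// lee_fin.
by rewrite integral_indic// setIT.
Qed.

Lemma integrable_indic_lty A : measurable A ->
  mu.-integrable setT (EFin \o \1_A) -> (mu A < +oo)%E.
Proof.
move=> mA /integrableP[_]; rewrite (eq_integral (fun x => (\1_A x)%:E)).
  by rewrite integral_indic// setIT.
by move=> t _; rewrite gee0_abs// lee_fin.
Qed.

Lemma Rintegral_indic A : measurable A ->
  Rintegral mu setT (\1_A : T -> R) = fine (mu A).
Proof. by move=> mA; rewrite /Rintegral integral_indic// setIT. Qed.

Lemma integrable_lincomb (a : R) f g : mu.-integrable setT (EFin \o f) ->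
  mu.-integrable setT (EFin \o g) ->
  mu.-integrable setT (EFin \o (fun x => a * f x + g x)).
Proof.
move=> fi gi; apply: (@integrableD _ _ _ mu setT _
  (EFin \o (fun x => a * f x)) (EFin \o g)) => //.
exact: (integrableZl measurableT _ fi).
Qed.

(** The functional acts on functions rather than on classes, so that indicators and translates can
    be inserted directly; only nonnegativity is asked outside the integrable functions. The single
    inequality for [a * f x + g x] packs subadditivity and homogeneity into one field. *)
Record L1_seminorm (M : R) (p : (T -> R) -> R) : Prop := MkL1Seminorm {
  L1_seminorm_ge0 : forall f, 0 <= p f;
  L1_seminorm_lin : forall (a : R) f g, mu.-integrable setT (EFin \o f) ->
    mu.-integrable setT (EFin \o g) ->
    p (fun x => a * f x + g x) <= `|a| * p f + p g;
  L1_seminorm_le : forall f, mu.-integrable setT (EFin \o f) ->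
    p f <= M * Rintegral mu setT (fun x => `|f x|) }.

Variables (M : R) (p : (T -> R) -> R).
Hypothesis p_semi : L1_seminorm M p.

Lemma L1_seminorm0 : p (cst 0) = 0.
Proof.
apply/eqP; rewrite eq_le (L1_seminorm_ge0 p_semi) andbT.
apply: le_trans (L1_seminorm_le p_semi (integrable0 _ _)) _.
rewrite (_ : (fun x => _) = cst 0); first by rewrite Rintegral_cst// mul0r mulr0.
by apply/funext => x; rewrite normr0.
Qed.

(** One-sided L^1 continuity of [p], the form in which every approximation below is used. *)
Lemma L1_seminormB f g : mu.-integrable setT (EFin \o f) ->
  mu.-integrable setT (EFin \o g) ->
  p f <= M * Rintegral mu setT (fun x => `|f x - g x|) + p g.
Proof.
move=> fi gi.
have fgi : mu.-integrable setT (EFin \o (fun x => f x - g x)).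
  rewrite (_ : _ \o _ = EFin \o (fun x => - 1 * g x + f x)).
    exact: integrable_lincomb.
  by apply/funext => x /=; rewrite mulN1r addrC.
rewrite [X in p X <= _](_ : _ = (fun x => 1 * (f x - g x) + g x)); last first.
  by apply/funext => x; rewrite mul1r subrK.
apply: le_trans (L1_seminorm_lin p_semi 1 fgi gi) _.
by rewrite normr1 mul1r lerD2r (L1_seminorm_le p_semi fgi).
Qed.

(** Subadditivity over the level sets carries the vanishing from indicators to integrable simple
    functions; these are L^1-dense, and domination by the L^1 norm passes to the limit. *)
Lemma L1_seminorm_eq0 :
  (forall A, measurable A -> (mu A < +oo)%E -> p \1_A = 0) ->
  forall f, mu.-integrable setT (EFin \o f) -> p f = 0.
Proof.
move=> p1 f fi.
have p_sfun (g : {sfun T >-> R}) :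
    mu.-integrable setT (EFin \o g) -> p g = 0.
  move=> gi.
  pose h (y : R) (x : T) : R := y * \1_(g @^-1` [set y]) x.
  have hi y : mu.-integrable setT (EFin \o h y).
    apply: (le_integrable measurableT _ _ gi) => /=.
      by apply/measurable_EFinP; apply: measurable_funM => //; exact: measurable_indic.
    move=> x _; rewrite lee_fin /h indicE; case: (boolP (x \in _)) => [|_].
      by rewrite inE /= => ->; rewrite mulr1.
    by rewrite mulr0 normr0.
  have ph y : p (h y) = 0.
    (* The level set of 0 may have infinite measure, but its term is the zero function. For
       [y != 0], dividing the integrable [h y] by [y] shows that the level set has finite
       measure. *)
    have [->|y0] := eqVneq y 0.
      rewrite (_ : h 0 = cst 0) ?L1_seminorm0//.
      by apply/funext => x; rewrite /h mul0r.
    have mA : measurable (g @^-1` [set y]) by exact: measurable_sfunP.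
    have yi : mu.-integrable setT (EFin \o \1_(g @^-1` [set y])).
      rewrite (_ : EFin \o _ = (fun x => y^-1%:E * (EFin \o h y) x)%E).
        exact: integrableZl.
      by apply/funext => x /=; rewrite /h -EFinM mulKf.
    have /(p1 _ mA) yp := integrable_indic_lty mA yi.
    apply/eqP; rewrite eq_le (L1_seminorm_ge0 p_semi) andbT.
    rewrite (_ : h y = fun x => y * \1_(g @^-1` [set y]) x + cst 0 x); last first.
      by apply/funext => x; rewrite addr0.
    apply: le_trans (L1_seminorm_lin p_semi _ yi (integrable0 _ _)) _.
    by rewrite yp L1_seminorm0 mulr0 addr0.
  have sumP (s : seq R) :
      mu.-integrable setT (EFin \o (fun x => \sum_(y <- s) h y x)) /\
      p (fun x => \sum_(y <- s) h y x) = 0.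
    elim: s => [|y s [si ps]].
      rewrite (_ : (fun x => _) = cst 0); last first.
        by apply/funext => x; rewrite big_nil.
      by rewrite L1_seminorm0; split => //; exact: integrable0.
    rewrite (_ : (fun x => _) = fun x => 1 * h y x + \sum_(z <- s) h z x); last first.
      by apply/funext => x; rewrite big_cons mul1r.
    split; first exact: integrable_lincomb.
    apply/eqP; rewrite eq_le (L1_seminorm_ge0 p_semi) andbT.
    apply: le_trans (L1_seminorm_lin p_semi _ (hi y) si) _.
    by rewrite ph ps mulr0 addr0.
  rewrite [X in p X](_ : _ = fun x => \sum_(y <- finmap.enum_fset (fset_set (range g))) h y x).
    by case: (sumP (finmap.enum_fset (fset_set (range g)))).
  by apply/funext => x; rewrite fimfunE fsbig_finite.
have [g [gi _ gf]] := approximation_sfun_integrable measurableT fi.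
apply/eqP; rewrite eq_le (L1_seminorm_ge0 p_semi) andbT.
have le n : p f <= M * Rintegral mu setT (fun x => `|f x - g n x|).
  by apply: le_trans (L1_seminormB fi (gi n)) _; rewrite p_sfun// addr0.
have : (fun n => M * Rintegral mu setT (fun x => `|f x - g n x|)) @ \oo --> M * 0.
  by apply: cvgMr; exact: (fine_cvg gf).
rewrite mulr0 => cvg0.
rewrite -(cvg_lim (@Rhausdorff R) cvg0); apply: limr_ge.
  exact: cvgP cvg0.
exact: nearW.
Qed.

End L1Seminorm.

(** * Compactness and uniformity in topological groups *)

Section TopologicalGroup.
Variables (G : topologicalZmodType).

Lemma addr_cvg0 (x : G) : (fun z : G * G => z.1 + z.2) @ (x, (0 : G)) --> x.
Proof. by rewrite -[X in _ --> X]addr0; exact: (@add_continuous G (x, 0)). Qed.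

Lemma shift_continuous (x : G) : continuous (fun y : G => y - x).
Proof.
move=> y; exact: (@continuous_comp _ _ _ (fun y => (y, x)) (fun z : G * G => z.1 - z.2) y
  (cvg_pair cvg_id (cvg_cst _)) (@sub_continuous G (y, x))).
Qed.

Lemma nbhs0N (U : set G) : nbhs 0 U -> \forall w \near (0 : G), U (- w).
Proof. by move=> U0; apply: (@opp_continuous G 0); rewrite oppr0. Qed.

(** Continuity of addition at each [(k, 0)] gives a condition on [w] that is local in [k];
    compactness of [K] makes it uniform. *)
Lemma nbhs0_compact_add (K U : set G) : compact K -> open U -> K `<=` U ->
  \forall w \near (0 : G), forall k, K k -> U (k + w).
Proof.
move=> /compact_near_coveringP cK oU KU.
apply: (cK _ (nbhs (0 : G)) (fun w k => U (k + w))) => k Kk.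
exact: (addr_cvg0 (open_nbhs_nbhs (conj oU (KU _ Kk)))).
Qed.

Lemma nbhs0_add (U : set G) : nbhs 0 U ->
  exists2 V, open_nbhs 0 V & forall v w, V v -> V w -> U (v + w).
Proof.
move=> U0; have [[V W] /= [V0 W0] VW] := addr_cvg0 U0.
exists (interior (V `&` W)).
  split; first exact: open_interior.
  exact: filterI V0 W0.
move=> v w /interior_subset[Vv _] /interior_subset[_ Ww].
exact: (VW (v, w)).
Qed.

Lemma compact_add (K L : set G) : compact K -> compact L ->
  compact [set k + l | k in K & l in L].
Proof.
move=> cK cL; have := continuous_compact
  (continuous_subspaceT (@add_continuous G)) (compact_setX cK cL).
congr compact; apply/seteqP; split=> [_ [[k l] [/= Kk Ll] <-]|_ [k Kk [l Ll <-]]].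
  by exists k => //; exists l.
by exists (k, l).
Qed.

(** Compactness gives the bound for [x] in the support. If [x] is outside and [x + w] is inside, the
    same bound is applied at [x + w] with increment [- w]; if [f] vanishes at both points there is
    nothing to show. *)
Lemma Cc_unif_continuous (R : realType) (f : G -> R) (e : R) :
  continuous f -> compact (closure [set x | f x != 0]) -> 0 < e ->
  \forall w \near (0 : G), forall x, `|f (x + w) - f x| <= e.
Proof.
move=> cf cK e0; set K := closure _ in cK.
have H : \forall w \near (0 : G), K `<=` (fun x => `|f (x + w) - f x| <= e).
  have /compact_near_coveringP cK' := cK.
  apply: (cK' _ (nbhs (0 : G)) (fun w x => `|f (x + w) - f x| <= e)) => x Kx.
  have fx : f z @[z --> x] --> f x by exact: cf.
  have fxw : f (z.1 + z.2) @[z --> (x, (0 : G))] --> f x.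
    exact: cvg_comp (@addr_cvg0 x) fx.
  have fx1 : f z.1 @[z --> (x, (0 : G))] --> f x.
    by apply: cvg_comp fx; exact: cvg_fst.
  have : f (z.1 + z.2) - f z.1 @[z --> (x, (0 : G))] --> (0 : R).
    by rewrite -(subrr (f x)); apply: cvgB.
  move=> /cvgrPdist_le/(_ _ e0).
  by apply: filterS => -[y w] /=; rewrite sub0r normrN.
near=> w => x.
have [fx|fx0] := eqVneq (f x) 0; last first.
  have : K `<=` (fun x => `|f (x + w) - f x| <= e) by near: w.
  by apply; exact: subset_closure.
have [fxw|fxw0] := eqVneq (f (x + w)) 0; first by rewrite fx fxw subr0 normr0 ltW.
have : K `<=` (fun x => `|f (x + - w) - f x| <= e) by near: w; exact: nbhs0N H.
move=> /(_ (x + w)); rewrite addrK distrC; apply.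
exact: subset_closure.
Unshelve. all: by end_near. Qed.

(** The centres are taken in [K] itself: this later confines the supports of the translates in a
    Riemann sum. *)
Lemma compact_translates (K W : set G) : compact K -> open_nbhs 0 W ->
  exists2 s : seq G, (forall x, x \in s -> K x) &
    forall y, K y -> exists2 x, x \in s & W (y - x).
Proof.
move=> cK [oW W0].
(* [compact_cover] is stated for pointed spaces only. *)
pose pG : ptopologicalType := HB.pack_for ptopologicalType G (isPointed.Build G 0).
have {}cK : @cover_compact G K by rewrite -[@cover_compact G](@compact_cover pG).
have [||s sK Ks] := cK G K (fun x => (fun y => y - x) @^-1` W).
- by move=> x _; apply: open_comp => // y _; exact: shift_continuous.
- by move=> x Kx; exists x => //=; rewrite subrr.
exists (finmap.enum_fset s) => [x xs|y /Ks[x xs Wyx]]; last by exists x.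
by have := sK x xs; rewrite inE.
Qed.

End TopologicalGroup.

(** * Vanishing of translation-decreasing seminorms for Haar measure *)

Section HaarSeminorm.
Variables (R : realType) (G : topologicalZmodType).
Variable mu : {measure set (borel G) -> \bar R}.
Hypotheses (hausdorffG : hausdorff_space G) (haar_mu : haar_measure mu).

Lemma open_borel (U : set G) : open U -> measurable (U : set (borel G)).
Proof. by move=> oU; apply: sub_sigma_algebra. Qed.

Lemma compact_borel (K : set G) : compact K -> measurable (K : set (borel G)).
Proof.
move=> cK; rewrite -[K]setCK; apply: measurableC; apply: open_borel.
exact/closed_openC/(compact_closed hausdorffG).
Qed.

Lemma haar_preimage_shift (x : G) (A : set (borel G)) : measurable A ->
  mu (((fun t => t - x) : borel G -> borel G) @^-1` A) = mu A.
Proof.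
move=> mA; rewrite -(haar_shift haar_mu x mA); congr (mu _).
apply/seteqP; split=> [y /= Ay|_ [y Ay <-]] /=; last by rewrite addrC addKr.
by exists (y - x) => //; rewrite addrC subrK.
Qed.

Lemma integrable_shift (x : G) (f : G -> R) :
  mu.-integrable setT (EFin \o f) ->
  mu.-integrable setT (EFin \o (fun t : G => f (t - x))).
Proof.
exact: (invariant_integrable (shift_measurable x) (haar_preimage_shift x)).
Qed.

Lemma Rintegral_shift (x : G) (f : G -> R) :
  mu.-integrable setT (EFin \o f) ->
  Rintegral mu setT (fun t : G => f (t - x)) = Rintegral mu setT f.
Proof.
move=> fi; rewrite /Rintegral; congr fine.
pose phi : {mfun borel G >-> borel G} :=
  HB.pack ((fun t => t - x) : borel G -> borel G)
    (isMeasurableFun.Build _ _ _ _ _ (shift_measurable x)).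
have /= <- := @integral_pushforward _ _ _ _ _ phi (shift_measurable x) mu setT
  (EFin \o f) (measurable_int mu fi) (integrable_shift x fi) measurableT.
rewrite (@eq_measure_integral _ _ _ setT mu (pushforward mu phi))//.
by move=> A mA _; exact: haar_preimage_shift.
Qed.

Lemma haar_outer_open (A : set G) (e : R) : measurable (A : set (borel G)) ->
  (mu A < +oo)%E -> 0 < e ->
  exists2 U : set G, open U /\ A `<=` U &
    (mu U < +oo)%E /\ fine (mu U) < fine (mu A) + e.
Proof.
move=> mA Aoo e0; have Afin : mu A \is a fin_num by rewrite ge0_fin_numE.
(* The adherence property requires a finite infimum; [eq_ind] transports finiteness from [mu A] to
   the infimum given by outer regularity. *)
have [_ [U [oU AU] <-]] := lb_ereal_inf_adherent e0
  (eq_ind _ (fun z => z \is a fin_num) Afin _ (haar_outer haar_mu mA)).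
rewrite -(haar_outer haar_mu mA) => Ue; exists U => //.
have Uoo : (mu U < +oo)%E.
  by apply: lt_trans Ue _; rewrite -(fineK Afin) -EFinD ltry.
split=> //; rewrite -lte_fin EFinD !fineK// ge0_fin_numE//.
Qed.

Lemma haar_inner_compact (U : set G) (e : R) : open U ->
  (mu U < +oo)%E -> 0 < e ->
  exists2 K : set G, compact K /\ K `<=` U & fine (mu U) < fine (mu K) + e.
Proof.
move=> oU Uoo e0; have Ufin : mu U \is a fin_num by rewrite ge0_fin_numE.
have [_ [K [cK KU] <-]] := ub_ereal_sup_adherent e0
  (eq_ind _ (fun z => z \is a fin_num) Ufin _ (haar_inner haar_mu oU)).
rewrite -(haar_inner haar_mu oU) => Ke; exists K => //.
have Kfin : mu K \is a fin_num by rewrite ge0_fin_numE//; exact: (haar_compact haar_mu cK).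
by rewrite -ltrBlDr -lte_fin EFinB !fineK.
Qed.

Variables (M : R) (p : (G -> R) -> R).
Hypothesis p_semi : L1_seminorm mu M p.
Hypothesis p_shift : forall (x : G) (f : G -> R),
  mu.-integrable setT (EFin \o f) -> p (fun t => f (t - x)) <= p f.

(** Induction on the centres: the part [E] of [A] in the first cell [x + W] contributes [mu E] times
    the translate of [d] by [x], and the rest of [A] is covered by the remaining cells. The weights
    are the measures of disjoint pieces, so they add up to [mu A]; this bounds both [p h] and the
    error. The last clause locates where [h] can be nonzero. *)
Lemma Riemann_sum_translates (d : G -> R) (W A : set G) (e : R) (s : seq G) :
  mu.-integrable setT (EFin \o d) -> (forall x, d (- x) = d x) ->
  open W -> (forall w x, W w -> `|d (x + w) - d x| <= e) ->
  measurable (A : set (borel G)) -> (mu A < +oo)%E ->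
  (forall y, A y -> exists2 x, x \in s & W (y - x)) ->
  exists h : G -> R, [/\ mu.-integrable setT (EFin \o h),
    p h <= fine (mu A) * p d,
    forall t, `|h t - Rintegral mu A (fun y : G => d (y - t))| <= e * fine (mu A) &
    forall t, h t != 0 -> exists2 x, x \in s & d (t - x) != 0].
Proof.
move=> di dN oW We.
elim: s A => [|x s IHs] A mA Aoo As.
  have -> : A = set0 by apply/seteqP; split => // y /As[].
  exists (cst 0); split.
  - exact: integrable0.
  - by rewrite (L1_seminorm0 p_semi) measure0 mul0r.
  - by move=> t; rewrite Rintegral_set0 measure0 subrr normr0 mulr0.
  - by move=> t; rewrite eqxx.
pose Wx : set (borel G) := [set y | W ((y : G) - x)].
have mWx : measurable Wx.
  by apply: open_borel; apply: open_comp => // y _; exact: shift_continuous.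
pose E : set (borel G) := A `&` Wx.
pose A' : set (borel G) := A `\` Wx.
have mE : measurable E by exact: measurableI.
have mA' : measurable A' by exact: measurableD.
have Eoo : (mu E < +oo)%E by apply: le_lt_trans Aoo; rewrite le_measure ?inE//; exact: subIsetl.
have A'oo : (mu A' < +oo)%E by apply: le_lt_trans Aoo; rewrite le_measure ?inE//; exact: subDsetl.
have AE : A = E `|` A' by rewrite /E /A' setUIDK.
have muA : fine (mu A) = fine (mu E) + fine (mu A').
  by rewrite (measureDI mu mA mWx) fineD ?ge0_fin_numE// addrC.
have [|h [hi ph he hs]] := IHs A' mA' A'oo.
  move=> y [Ay nWy]; have [z] := As y Ay.
  by rewrite inE => /predU1P[->//|zs Wyz]; exists z.
have dxi := integrable_shift x di.
exists (fun t => fine (mu E) * d (t - x) + h t); split.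
- exact: integrable_lincomb.
- apply: le_trans (L1_seminorm_lin p_semi _ dxi hi) _.
  rewrite ger0_norm ?fine_ge0// muA mulrDl lerD// ler_wpM2l ?fine_ge0//.
  exact: p_shift.
- move=> t; have dti := integrable_shift t di.
  rewrite [in Rintegral _ _ _]AE Rintegral_setU//; last 2 first.
  + by apply: integrableS dti => //; exact: measurableU.
  + by rewrite disj_set2E; apply/eqP/seteqP; split => // y [[_ ?] []].
  rewrite opprD addrACA muA mulrDr; apply: le_trans (ler_normD _ _) _.
  apply: lerD => //.
  have cE (r : R) : mu.-integrable E (EFin \o cst r).
    by apply: measurable_bounded_integrable => //; exact: bounded_cst.
  have dE : mu.-integrable E (EFin \o (fun y : G => d (y - t))).
    exact: integrableS dti.
  (* The new term is the integral over [E] of the constant [d (t - x)], so the error on [E] is the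
     integral of a difference that is at most [e] in modulus. *)
  rewrite mulrC -!(Rintegral_cst mu mE) -RintegralB//; last exact: cE.
  have cdE := integrableB mE (cE (d (t - x))) dE.
  apply: le_trans (le_normr_Rintegral mE cdE) _.
  apply: le_Rintegral => //; [exact: integrable_norm|exact: cE|].
  (* Evenness turns [d (t - x)] into [d (x - t)], whose argument differs from [y - t] by [y - x], an
     element of [W]. *)
  move=> y [_ Wy]; rewrite -dN opprB.
  have -> : (y : G) - t = (x - t) + (y - x) by rewrite [RHS]addrC addrA subrK.
  by rewrite distrC; exact: We.
- move=> t; have [->|d0 _] := eqVneq (d (t - x)) 0; last first.
    by exists x => //; rewrite mem_head.
  by rewrite mulr0 add0r => /hs[z zs dz]; exists z => //; rewrite inE zs orbT.
Qed.

Hypothesis M_ge0 : 0 <= M.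
Hypothesis p_dirac : forall (U : set G) (e : R), open_nbhs 0 U -> 0 < e ->
  exists d : G -> R, [/\ continuous d, compact (closure [set x | d x != 0]),
    closure [set x | d x != 0] `<=` U, forall x, 0 <= d x &
    forall x, d (- x) = d x] /\
  [/\ mu.-integrable setT (EFin \o d), Rintegral mu setT d = 1 & p d <= e].

Let p_ge0 (f : G -> R) : 0 <= p f.
Proof. exact: L1_seminorm_ge0 p_semi f. Qed.

(** The quantity [fine (mu K) + e] bounds the measure of an open [U] around [K], hence also that of
    [K']. In the L^1 bound, the first [e] comes from [U] minus [K], and the second term is the
    Riemann error [e * mu U] integrated over [U]. *)
Lemma translates_approx_indic (K : set G) (e : R) : compact K -> 0 < e ->
  exists h : G -> R, [/\ mu.-integrable setT (EFin \o h),
    p h <= (fine (mu K) + e) * e &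
    Rintegral mu setT (fun t => `|\1_K t - h t|) <= e + e * (fine (mu K) + e) ^+ 2].
Proof.
move=> cK e0; have mK := compact_borel cK; have Koo := haar_compact haar_mu cK.
have [U [oU KU] [Uoo Ue]] := haar_outer_open mK Koo e0.
(* [U] contains [K + V + V]: one copy of [V] is for [K'], the sum of [K] and the support of [d], the
   other for the translates of [d] centred in [K']. *)
have [V V0 VU] := nbhs0_add (nbhs0_compact_add cK oU KU).
have [d [[cd cS SV d0 dN] [di d1 pd]]] := p_dirac V0 e0.
set S := closure _ in cS SV.
have dS x : d x != 0 -> S x by move=> dx; exact: subset_closure.
pose K' : set (borel G) := [set k + s | k in K & s in S].
have cK' : compact (K' : set G) by exact: compact_add.
have mK' := compact_borel cK'.
have K'VU (x v : G) : K' x -> V v -> U (x + v).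
  by move=> [k Kk [s /SV Vs <-]] Vv; rewrite -addrA; exact: VU.
have K'U : K' `<=` U by move=> x K'x; rewrite -[x]addr0; apply: K'VU => //; case: V0.
have mU := open_borel oU.
have K'oo : (mu K' < +oo)%E by apply: le_lt_trans Uoo; rewrite le_measure ?inE.
have K'leU : fine (mu K') <= fine (mu U).
  by rewrite fine_le ?ge0_fin_numE// le_measure ?inE.
have [W W0 We] : exists2 W, open_nbhs (0 : G) W &
    forall w x, W w -> `|d (x + w) - d x| <= e.
  have dcont := Cc_unif_continuous cd cS e0.
  exists (interior [set w | forall x, `|d (x + w) - d x| <= e]).
    by split => //; exact: open_interior.
  by move=> w x /interior_subset; exact.
have [s sK' Ks] := compact_translates cK' W0.
have [h [hi ph he hs]] := Riemann_sum_translates di dN W0.1 We mK' K'oo Ks.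
exists h; split => //.
  apply: le_trans ph _; apply: ler_pM => //.
  exact: le_trans K'leU (ltW Ue).
pose I t := Rintegral mu K' (fun y : G => d (y - t)).
have I0 t : 0 <= I t by apply: Rintegral_ge0.
have dti t := integrable_shift t di.
have dtKi t : mu.-integrable setT (EFin \o ((fun y : G => d (y - t)) \_ K')).
  rewrite -restrict_EFin; apply/(integrable_mkcond _ mK').
  by apply: (integrableS measurableT mK' _ (dti t)).
have I1 t : I t <= 1.
  rewrite -d1 -(Rintegral_shift t di) /I Rintegral_mkcond.
  apply: le_Rintegral => // x _; rewrite patchE; case: ifP => // _; exact: d0.
(* For [t] in [K], the translate of [d] by [t] is supported in [t + S], which lies in [K'], so the
   restriction to [K'] loses no mass. *)
have IK t : K t -> I t = 1.
  move=> Kt; rewrite -d1 -(Rintegral_shift t di) /I Rintegral_mkcond.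
  apply: eq_Rintegral => x _; rewrite patchE; case: ifPn => // /negP K'x.
  apply/esym/eqP/negPn/negP => /dS dx; apply: K'x; rewrite inE.
  by exists t => //; exists ((x : G) - t) => //; rewrite addrC subrK.
have hU t : ~ U t -> h t = 0.
  move=> Ut; apply/eqP/negPn/negP => /hs[x /sK' K'x /dS/SV].
  by move=> /(K'VU _ _ K'x); rewrite addrC subrK.
(* Outside [U] both functions vanish; on [K] only the Riemann error remains, since [I t = 1]; on the
   rest of [U], [h t] is at most [I t <= 1] plus that error. *)
have bnd t : `|\1_K t - h t| <= \1_(U `\` K) t + (e * fine (mu U)) * \1_U t.
  have heU : `|h t - I t| <= e * fine (mu U).
    by apply: le_trans (he t) _; rewrite ler_pM2l.
  have [Ut|Ut] := pselect (U t); last first.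
    have Kt : ~ K t by move=> /KU.
    have UKt : ~ (U `\` K) t by case.
    by rewrite hU// subr0 !indicE !memNset//= normr0 mulr0 addr0.
  have [Kt|Kt] := pselect (K t).
    rewrite !indicE mem_set// memNset; last by case.
    by rewrite mem_set// add0r mulr1 -(IK t Kt) distrC.
  rewrite !indicE memNset// mem_set// mem_set// mulr1 sub0r normrN.
  have -> : h t = (h t - I t) + I t by rewrite subrK.
  apply: le_trans (ler_normD _ _) _; rewrite addrC lerD// ger0_norm//.
have mUK : measurable (U `\` K : set (borel G)) by exact: measurableD.
have UKoo : (mu (U `\` K) < +oo)%E.
  by apply: le_lt_trans Uoo; rewrite le_measure ?inE//; exact: subDsetl.
have muUK : fine (mu (U `\` K)) <= e.
  have := measureDI mu mU mK; rewrite setIidr// => mUE.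
  move: Ue; rewrite mUE fineD ?ge0_fin_numE// => /ltW.
  by rewrite addrC lerD2l.
have UKi := integrable_indic_fin mUK UKoo.
have Ui := integrable_indic_fin mU Uoo.
have Ki := integrable_indic_fin mK Koo.
have bi := integrable_lincomb (e * fine (mu U)) Ui UKi.
have Khi := integrableB measurableT Ki hi.
apply: (@le_trans _ _ (Rintegral mu setT
  (fun t => (e * fine (mu U)) * \1_U t + \1_(U `\` K) t))).
  apply: le_Rintegral => //; first exact: integrable_norm.
  by move=> t _; rewrite [leRHS]addrC; exact: bnd.
rewrite RintegralD//; last exact: (integrableZl measurableT _ Ui).
rewrite RintegralZl// !Rintegral_indic// addrC lerD//.
have Ke0 : 0 <= fine (mu K) + e by rewrite addr_ge0 ?fine_ge0// ltW.
by rewrite -mulrA ler_pM2l// -expr2 ler_sqr ?nnegrE ?fine_ge0// ltW.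
Qed.

Lemma L1_seminorm_compact (K : set G) : compact K -> p \1_K = 0.
Proof.
move=> cK; have mK := compact_borel cK; have Koo := haar_compact haar_mu cK.
have Ki := integrable_indic_fin mK Koo.
(* For [e <= 1], the number [B] bounds [fine (mu K) + e], and the two bounds of the approximation
   add up to at most [e * C]. *)
pose B := fine (mu K) + 1; pose C := M * (1 + B ^+ 2) + B.
have B1 : 1 <= B by rewrite lerDr fine_ge0.
have C0 : 0 < C.
  apply: ltr_wpDl; last exact: lt_le_trans B1.
  by rewrite mulr_ge0// addr_ge0// sqr_ge0.
have le e : 0 < e -> e <= 1 -> p \1_K <= e * C.
  move=> e0 e1; have [h [hi ph hK]] := translates_approx_indic cK e0.
  apply: le_trans (L1_seminormB p_semi Ki hi) _.
  have mKB : fine (mu K) + e <= B by rewrite lerD2l.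
  have mK0 : 0 <= fine (mu K) + e by rewrite addr_ge0 ?fine_ge0// ltW.
  rewrite /C mulrDr mulrCA lerD//.
    rewrite ler_wpM2l//; apply: le_trans hK _.
    rewrite mulrDr mulr1 lerD2l ler_wpM2l ?(ltW e0)// ler_sqr ?nnegrE//.
    exact: le_trans mKB.
  apply: le_trans ph _; by rewrite mulrC ler_wpM2l// ltW.
apply: le_anti; rewrite p_ge0 andbT leNgt; apply/negP => p0.
(* With this choice the bound [e * C] is at most half of [p \1_K], a contradiction if the latter is
   positive. *)
pose e := Num.min 1 (p \1_K / (2 * C)).
have e0 : 0 < e by rewrite lt_min ltr01 divr_gt0// mulr_gt0.
have /(le e e0) : e <= 1 by rewrite ge_min lexx.
have : e * C <= p \1_K / 2.
  apply: (@le_trans _ _ (p \1_K / (2 * C) * C)).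
    by rewrite ler_wpM2r ?(ltW C0)// ge_min lexx orbT.
  by rewrite invfM mulrA divfK// gt_eqF.
move=> h1 h2; have := le_trans h2 h1.
by rewrite leNgt ltr_pdivrMr// ltr_pMr// ltr1n.
Qed.

(** Inner regularity is available for open sets, so [A] is compared with a compact [K] through an
    open [U] containing both. [K] need not lie in [A]: the difference of the indicators is dominated
    by those of [U] minus [A] and [U] minus [K]. *)
Lemma L1_seminorm_measurable (A : set (borel G)) :
  measurable A -> (mu A < +oo)%E -> p \1_A = 0.
Proof.
move=> mA Aoo; apply: le_anti; rewrite p_ge0 andbT.
apply/ler_addgt0Pr => e e0; rewrite add0r.
(* Two errors of size [r], multiplied by [M], must stay below [e]; [M + 1] avoids division by 0 when
   [M = 0]. *)
pose r := e / (2 * (M + 1)).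
have M1 : 0 < M + 1 by rewrite ltr_wpDl.
have r0 : 0 < r by rewrite divr_gt0// mulr_gt0.
have [U [oU AU] [Uoo Ue]] := haar_outer_open mA Aoo r0.
have [K [cK KU] Ke] := haar_inner_compact oU Uoo r0.
have mU := open_borel oU; have mK := compact_borel cK.
have Koo := haar_compact haar_mu cK.
have Ai := integrable_indic_fin mA Aoo.
have Ki := integrable_indic_fin mK Koo.
apply: le_trans (L1_seminormB p_semi Ai Ki) _; rewrite L1_seminorm_compact// addr0.
have diff (B : set (borel G)) : measurable B -> B `<=` U -> fine (mu U) < fine (mu B) + r ->
    (mu (U `\` B) < +oo)%E /\ fine (mu (U `\` B)) <= r.
  move=> mB BU Br; have mUB := measurableD mU mB.
  have UBoo : (mu (U `\` B) < +oo)%E.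
    by apply: le_lt_trans Uoo; rewrite le_measure ?inE//; exact: subDsetl.
  have Boo : (mu B < +oo)%E by apply: le_lt_trans Uoo; rewrite le_measure ?inE.
  split => //; move: Br; have := measureDI mu mU mB; rewrite setIidr// => ->.
  by rewrite fineD ?ge0_fin_numE// addrC => /ltW; rewrite lerD2l.
have [UAoo UAr] := diff A mA AU Ue; have [UKoo UKr] := diff K mK KU Ke.
have UAi := integrable_indic_fin (measurableD mU mA) UAoo.
have UKi := integrable_indic_fin (measurableD mU mK) UKoo.
have AKi := integrableB measurableT Ai Ki.
apply: (@le_trans _ _ (M * (r + r))).
  rewrite ler_wpM2l//.
  apply: (@le_trans _ _ (Rintegral mu setT (fun t => \1_(U `\` A) t + \1_(U `\` K) t))).
    apply: le_Rintegral => //; first exact: integrable_norm.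
      exact: (@integrableD _ _ _ mu setT _
        (EFin \o \1_(U `\` A)) (EFin \o \1_(U `\` K))).
    move=> t _ /=; rewrite !indicE !in_setD.
    have AUt : t \in A -> t \in U by rewrite !inE; exact: AU.
    have KUt : t \in K -> t \in U by rewrite !inE; exact: KU.
    move: AUt KUt; case: (t \in A); case: (t \in K); case: (t \in U) => AUt KUt;
      try by [have := AUt isT | have := KUt isT];
      by rewrite /= ?(subrr, subr0, sub0r, normrN, normr0, normr1, addr0, add0r, addr_ge0).
  rewrite RintegralD// !Rintegral_indic//; [exact: lerD|exact: measurableD|exact: measurableD].
have <- : (M + 1) * (r + r) = e.
  by rewrite -mulr2n -(mulr_natl r 2) mulrA [_ * 2]mulrC [LHS]mulrC /r divfK// gt_eqF// mulr_gt0.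
by rewrite ler_wpM2r ?lerDl// addr_ge0// ltW.
Qed.

Lemma L1_seminorm_vanishes (f : G -> R) :
  mu.-integrable setT (EFin \o f) -> p f = 0.
Proof. exact: (L1_seminorm_eq0 p_semi L1_seminorm_measurable). Qed.

End HaarSeminorm.

(** * Real functions as classes in complex L^1 *)

Section RealToL1.
Context d (T : measurableType d) (R : realType).
Variable mu : {measure set T -> \bar R}.
Implicit Types f g : T -> R.

Lemma cintegrable_real g : mu.-integrable setT (EFin \o g) ->
  cintegrable mu (fun x => (g x)%:C).
Proof. by move=> gi; split => //; exact: integrable0. Qed.

(** Integrability matters here, because [toL1] sends every nonintegrable function to 0. *)
Lemma toL1_lincomb (a : R) f g : mu.-integrable setT (EFin \o f) ->
  mu.-integrable setT (EFin \o g) ->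
  toL1 mu (fun x => (a * f x + g x)%:C) =
  a%:C *: toL1 mu (fun x => (f x)%:C) + toL1 mu (fun x => (g x)%:C).
Proof.
move=> fi gi; apply/L1P.
have fP := toL1P (cintegrable_real fi).
have gP := toL1P (cintegrable_real gi).
have fgP := toL1P (cintegrable_real (integrable_lincomb a fi gi)).
move: (toL1 _ _) (toL1 _ _) (toL1 _ _) fP gP fgP => FH H F fP gP fgP.
have addP := L1_addE (a%:C *: F) H; have scaleP := L1_scaleE a%:C F.
near=> x.
have -> : FH x = (a * f x + g x)%:C by near: x.
have -> : (a%:C *: F + H : L1 mu) x = (a%:C *: F : L1 mu) x + H x by near: x.
have -> : (a%:C *: F : L1 mu) x = a%:C * F x by near: x.
have -> : F x = (f x)%:C by near: x.
have -> : H x = (g x)%:C by near: x.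
by rewrite rmorphD rmorphM.
Unshelve. all: by end_near. Qed.

Lemma norm_toL1_real g : mu.-integrable setT (EFin \o g) ->
  `|toL1 mu (fun x => (g x)%:C)| = (Rintegral mu setT (fun x => `|g x|))%:C.
Proof.
move=> gi; have gC := cintegrable_real gi.
rewrite [LHS](L1normE gC (toL1P gC)); congr _%:C.
apply: eq_Rintegral => x _ /=.
by rewrite expr0n addr0 sqrtr_sqr.
Qed.

(** Reduces an identity between complex linear maps on L^1 to real functions. *)
Lemma L1_real_im (f : L1 mu) :
  f = toL1 mu (fun x => (complex.Re (f x))%:C) +
      'i *: toL1 mu (fun x => (complex.Im (f x))%:C).
Proof.
have [fr fi] := L1_cintegrable f; apply/L1P.
have rP := toL1P (cintegrable_real fr).
have iP := toL1P (cintegrable_real fi).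
move: (toL1 _ _) (toL1 _ _) rP iP => H F rP iP.
have addP := L1_addE F ('i *: H); have scaleP := L1_scaleE 'i H.
near=> x.
have -> : (F + 'i *: H : L1 mu) x = F x + ('i *: H : L1 mu) x by near: x.
have -> : ('i *: H : L1 mu) x = 'i * H x by near: x.
have -> : F x = (complex.Re (f x))%:C by near: x.
have -> : H x = (complex.Im (f x))%:C by near: x.
exact: complexE.
Unshelve. all: by end_near. Qed.

End RealToL1.

(** * The Fourier integral of real functions at a fixed character *)

Lemma norm_Re_le (R : realType) (z : R[i]) : `|complex.Re z| <= complex.Re `|z|.
Proof.
case: z => a b /=.
by rewrite -[leLHS]sqrtr_sqr ler_wsqrtr// lerDl sqr_ge0.
Qed.

Lemma norm_Im_le (R : realType) (z : R[i]) : `|complex.Im z| <= complex.Re `|z|.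
Proof.
case: z => a b /=.
by rewrite -[leLHS]sqrtr_sqr ler_wsqrtr// lerDr sqr_ge0.
Qed.

Lemma Rintegral_lincomb d (T : measurableType d) (R : realType)
    (mu : {measure set T -> \bar R}) (a b : R) (f g : T -> R) :
  mu.-integrable setT (EFin \o f) -> mu.-integrable setT (EFin \o g) ->
  Rintegral mu setT (fun x => a * f x + b * g x) =
  a * Rintegral mu setT f + b * Rintegral mu setT g.
Proof.
move=> fi gi; rewrite RintegralD ?RintegralZl//.
- exact: (integrableZl measurableT _ fi).
- exact: (integrableZl measurableT _ gi).
Qed.

Section CharacterIntegral.
Variables (R : realType) (G : topologicalZmodType).
Variable mu : {measure set (borel G) -> \bar R}.
Variable chi : dual G R.
Implicit Types f g : G -> R.

(** The Fourier transform at [chi] of a real [f]; the minus sign comes from the conjugate of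
    [chi]. *)
Definition char_integral f : R[i] :=
  Rintegral mu setT (fun x : G => f x * complex.Re (chi x)) -i*
  Rintegral mu setT (fun x : G => f x * complex.Im (chi x)).

Lemma continuous_borel_measurable f : continuous f ->
  measurable_fun setT (f : borel G -> R).
Proof.
move=> cf.
apply: (@measurability _ _ (borel G) _ setT _ _ (RGenOpens.measurableE R)).
move=> _ [_ [a [b ->] <-]]; rewrite setTI; apply: sub_sigma_algebra.
by move/continuousP : cf; apply; exact: interval_open.
Qed.

Lemma integrable_mul_bounded f g : mu.-integrable setT (EFin \o f) ->
  continuous g -> (forall x, `|g x| <= 1) ->
  mu.-integrable setT (EFin \o (fun x : G => f x * g x)).
Proof.
move=> fi cg g1; apply: (le_integrable measurableT _ _ fi).
  apply/measurable_EFinP; apply: measurable_funM.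
    by apply/measurable_EFinP; exact: measurable_int fi.
  exact: continuous_borel_measurable.
by move=> x _ /=; rewrite lee_fin normrM ler_piMr.
Qed.

Lemma char_Re_le1 x : `|complex.Re (chi x)| <= 1.
Proof. by apply: le_trans (norm_Re_le _) _; rewrite char_norm. Qed.

Lemma char_Im_le1 x : `|complex.Im (chi x)| <= 1.
Proof. by apply: le_trans (norm_Im_le _) _; rewrite char_norm. Qed.

Lemma char_Re_continuous : continuous (fun x => complex.Re (chi x)).
Proof.
by move=> x; apply: continuous_comp; [exact: char_continuous|exact: Re_continuous].
Qed.

Lemma char_Im_continuous : continuous (fun x => complex.Im (chi x)).
Proof.
by move=> x; apply: continuous_comp; [exact: char_continuous|exact: Im_continuous].
Qed.

Lemma integrable_char_Re f : mu.-integrable setT (EFin \o f) ->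
  mu.-integrable setT (EFin \o (fun x : G => f x * complex.Re (chi x))).
Proof.
by move=> fi; apply: integrable_mul_bounded fi char_Re_continuous char_Re_le1.
Qed.

Lemma integrable_char_Im f : mu.-integrable setT (EFin \o f) ->
  mu.-integrable setT (EFin \o (fun x : G => f x * complex.Im (chi x))).
Proof.
by move=> fi; apply: integrable_mul_bounded fi char_Im_continuous char_Im_le1.
Qed.

Lemma char_integral_lincomb (a : R) f g : mu.-integrable setT (EFin \o f) ->
  mu.-integrable setT (EFin \o g) ->
  char_integral (fun x => a * f x + g x) =
  a%:C * char_integral f + char_integral g.
Proof.
move=> fi gi.
have lin (h : G -> R) : mu.-integrable setT (EFin \o (fun x : G => f x * h x)) ->
    mu.-integrable setT (EFin \o (fun x : G => g x * h x)) ->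
    Rintegral mu setT (fun x : G => (a * f x + g x) * h x) =
    a * Rintegral mu setT (fun x : G => f x * h x) +
    Rintegral mu setT (fun x : G => g x * h x).
  move=> fhi ghi; rewrite -RintegralZl// -RintegralD//.
    by apply: eq_Rintegral => x _; rewrite mulrDl mulrA.
  exact: (integrableZl measurableT _ fhi).
rewrite /char_integral !lin; try exact: integrable_char_Re; try exact: integrable_char_Im.
by apply/eqP; rewrite eq_complex /= !mul0r subr0 addr0 opprD mulrN !eqxx.
Qed.

(** The factor 2 arises from bounding the real and imaginary parts separately; any constant serves
    for domination. *)
Lemma char_integral_le f : mu.-integrable setT (EFin \o f) ->
  complex.Re `|char_integral f| <= 2 * Rintegral mu setT (fun x => `|f x|).
Proof.
move=> fi; apply: le_trans (Re_norm_le _) _.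
have bnd (h : G -> R) : mu.-integrable setT (EFin \o (fun x : G => f x * h x)) ->
    (forall x, `|h x| <= 1) ->
    `|Rintegral mu setT (fun x : G => f x * h x)| <= Rintegral mu setT (fun x => `|f x|).
  move=> fhi h1; apply: le_trans (le_normr_Rintegral measurableT fhi) _.
  apply: le_Rintegral => //; try exact: integrable_norm.
  by move=> x _; rewrite normrM ler_piMr.
rewrite mulr_natl mulr2n /= normrN lerD//; apply: bnd.
- exact: integrable_char_Re.
- exact: char_Re_le1.
- exact: integrable_char_Im.
- exact: char_Im_le1.
Qed.

Lemma cintegral_char (f : G -> R[i]) : cintegrable mu f ->
  cintegral mu (fun x : borel G => f x * (chi x)^*) =
  char_integral (fun x => complex.Re (f x)) +
  'i * char_integral (fun x => complex.Im (f x)).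
Proof.
move=> [fr fi]; apply/eqP; rewrite eq_complex /= !mul0r !mul1r !add0r opprK.
apply/andP; split; apply/eqP.
- rewrite -RintegralD//; [|exact: integrable_char_Re|exact: integrable_char_Im].
  by apply: eq_Rintegral => x _; case: (f x) (chi x) => a b [u v] /=; rewrite mulrN opprK.
- rewrite addrC -RintegralB//; [|exact: integrable_char_Re|exact: integrable_char_Im].
  by apply: eq_Rintegral => x _; case: (f x) (chi x) => a b [u v] /=; rewrite mulrN addrC.
Qed.

Hypothesis haar_mu : haar_measure mu.

(** Since [chi t = chi (t - x) * chi x], each part of the integrand is a real combination [F] of the
    two parts of [f * chi], evaluated at [t - x]; translation invariance then removes the shift. *)
Lemma char_integral_shift (x : G) f : mu.-integrable setT (EFin \o f) ->
  char_integral (fun t => f (t - x)) = (chi x)^* * char_integral f.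
Proof.
move=> fi.
have fri := integrable_char_Re fi; have fii := integrable_char_Im fi.
have chiE (t : G) : chi t = chi (t - x) * chi x by rewrite -charD subrK.
pose F (a b : R) (t : G) :=
  a * (f t * complex.Re (chi t)) + b * (f t * complex.Im (chi t)).
have shiftF a b : Rintegral mu setT (fun t : G => F a b (t - x)) =
    a * Rintegral mu setT (fun t : G => f t * complex.Re (chi t)) +
    b * Rintegral mu setT (fun t : G => f t * complex.Im (chi t)).
  rewrite (Rintegral_shift haar_mu x (f := F a b)); first exact: Rintegral_lincomb.
  exact: integrable_lincomb fri (integrableZl measurableT _ fii).
case Ex : (chi x) chiE => [u v] chiE.
apply/eqP; rewrite eq_complex /=; apply/andP; split; apply/eqP.
  transitivity (Rintegral mu setT (fun t : G => F u (- v) (t - x))).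
    apply: eq_Rintegral => t _; rewrite [in LHS]chiE /F.
    by case: (chi (t - x)) => a b /=; ring.
  by rewrite shiftF; ring.
transitivity (- Rintegral mu setT (fun t : G => F v u (t - x))).
  congr (- _); apply: eq_Rintegral => t _; rewrite [in LHS]chiE /F.
  by case: (chi (t - x)) => a b /=; ring.
by rewrite shiftF; ring.
Qed.

(** As [f] has integral 1, the difference is an average of the conjugate of [chi - 1] against [f],
    which lives where [chi] is within [e] of 1. Each of the two parts costs [e]. *)
Lemma char_integral_dirac (f : G -> R) (e : R) :
  mu.-integrable setT (EFin \o f) -> (forall x, 0 <= f x) ->
  Rintegral mu setT f = 1 ->
  (forall x, f x != 0 -> complex.Re `|chi x - 1| <= e) ->
  complex.Re `|char_integral f - 1| <= 2 * e.
Proof.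
move=> fi f0 f1 fe; apply: le_trans (Re_norm_le _) _.
have bnd (h : G -> R) : mu.-integrable setT (EFin \o (fun x : G => f x * h x)) ->
    (forall x, `|h x| <= complex.Re `|chi x - 1|) ->
    `|Rintegral mu setT (fun x : G => f x * h x)| <= e.
  move=> fhi he; apply: le_trans (le_normr_Rintegral measurableT fhi) _.
  rewrite -[e]mulr1 -f1 -RintegralZl//.
  apply: le_Rintegral => //; first exact: integrable_norm.
    exact: (integrableZl measurableT _ fi).
  move=> x _; rewrite normrM (ger0_norm (f0 x)) mulrC.
  have [->|fx0] := eqVneq (f x) 0; first by rewrite !mulr0.
  by rewrite ler_wpM2r// (le_trans (he x))// fe.
have fri := integrable_char_Re fi.
rewrite mulr_natl mulr2n /= subr0 normrN lerD//.
- rewrite -f1 -RintegralB//.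
  rewrite (_ : Rintegral _ _ _ =
    Rintegral mu setT (fun x : G => f x * (complex.Re (chi x) - 1))); last first.
    by apply: eq_Rintegral => x _; rewrite mulrBr mulr1.
  apply: bnd.
    rewrite (_ : _ \o _ = EFin \o (fun x : G =>
      - 1 * f x + f x * complex.Re (chi x))); first exact: integrable_lincomb.
    by apply/funext => x /=; congr _%:E; ring.
  by move=> x; apply: le_trans (norm_Re_le _); case: (chi x).
- apply: bnd; first exact: integrable_char_Im.
  by move=> x; apply: le_trans (norm_Im_le _); case: (chi x) => u v /=; rewrite subr0.
Qed.

End CharacterIntegral.

(** * Translation of classes and identification of the operator *)

Lemma ae_shift (R : realType) (G : topologicalZmodType)
    (mu : {measure set (borel G) -> \bar R}) (haar_mu : haar_measure mu)
    (x : G) (Q : G -> Prop) :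
  {ae mu, forall t, Q t} -> {ae mu, forall t : borel G, Q ((t : G) - x)}.
Proof.
move=> [A [mA A0 QA]]; exists (((fun t => t - x) : borel G -> borel G) @^-1` A).
split; last by move=> t /QA.
  by rewrite -[_ @^-1` _]setTI; exact: (shift_measurable x).
by rewrite haar_preimage_shift.
Qed.

(** [Lshift] works on a chosen representative; invariance of null sets under translation makes the
    choice immaterial. *)
Lemma toL1_real_shift (R : realType) (G : topologicalZmodType)
    (mu : {measure set (borel G) -> \bar R}) (haar_mu : haar_measure mu)
    (x : G) (g : G -> R) : mu.-integrable setT (EFin \o g) ->
  toL1 mu (fun t : G => (g (t - x))%:C) =
  Lshift x (toL1 mu (fun t => (g t)%:C)).
Proof.
move=> gi; apply/L1P.
have gxP := toL1P (cintegrable_real (integrable_shift haar_mu x gi)).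
have LP := LshiftE haar_mu x (toL1 mu (fun t => (g t)%:C)).
have gP := ae_shift haar_mu x (toL1P (cintegrable_real gi)).
by apply: filterS3 gxP LP gP => t -> -> ->.
Qed.

Lemma nbhs_char_near1 (R : realType) (G : topologicalZmodType) (chi : dual G R)
    (e : R) : 0 < e ->
  exists2 U : set G, open_nbhs 0 U &
    forall x, U x -> complex.Re `|chi x - 1| <= e.
Proof.
move=> e0; have e0' : 0 < e%:C :> R[i] by rewrite ltcR.
have chi0 : chi 0 = 1.
  have chi00 : chi 0 != 0 by rewrite -normr_eq0 char_norm oner_eq0.
  by apply: (mulIf chi00); rewrite mul1r -charD addr0.
have : \forall x \near (0 : G), `|chi 0 - chi x| < e%:C.
  exact: (@cvgr_dist_lt _ _ _ (nbhs (0 : G)) _ chi (chi 0) (@char_continuous _ _ chi 0) _ e0').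
move=> near0; exists (interior [set x | `|chi 0 - chi x| < e%:C]).
  by split => //; exact: open_interior.
move=> x /interior_subset /=; rewrite chi0 distrC => /ltW.
by rewrite normCE lecR.
Qed.

Theorem theorem3 (R : realType) (G : topologicalZmodType)
    (hausdorffG : hausdorff_space G) (lcG : locally_compact [set: G])
    (mu : {measure set (borel G) -> \bar R}) (haar_mu : haar_measure mu)
    (T : {linear L1 mu -> Cb (dual G R) R})
    (T_bounded : exists M : R, forall f : L1 mu, `|T f| <= M%:C * `|f|)
    (time_shift : forall (f : L1 mu) (x : G) (chi : dual G R),
      (T (Lshift x f) : Cb _ _) chi = (chi x)^* * (T f : Cb _ _) chi)
    (dirac_delta : exists2 delta : set G -> G -> R[i],
      dirac_family mu delta &
      forall (chi : dual G R) (eps : R), 0 < eps ->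
        exists2 U : set G, open_nbhs 0 U &
          forall V : set G, open_nbhs 0 V -> V `<=` U ->
            `|(T (toL1 mu (delta V)) : Cb _ _) chi - 1| < eps%:C) :
  forall (f : L1 mu) (chi : dual G R),
    (T f : Cb _ _) chi = cintegral mu (fun x : borel G => f x * (chi x)^*).
Proof.
have [M TM] := T_bounded; have [delta deltaP deltalim] := dirac_delta.
move=> f chi.
pose P (g : G -> R) : R[i] := (T (toL1 mu (fun x => (g x)%:C)) : Cb _ _) chi.
pose Q (g : G -> R) : R[i] := char_integral mu chi g.
pose p g := complex.Re `|P g - Q g|.
have P_lin (a : R) g h : mu.-integrable setT (EFin \o g) ->
    mu.-integrable setT (EFin \o h) ->
    P (fun x => a * g x + h x) = a%:C * P g + P h.
  by move=> gi hi; rewrite /P toL1_lincomb// linearD linearZ.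
(* [|M|] bounds the contribution of [T], the sign of [M] being unknown, and 2 that of the Fourier
   integral. *)
have p_semi : L1_seminorm mu (`|M| + 2) p.
  split=> [g|a g h gi hi|g gi]; first exact: Re_norm_ge0.
    rewrite /p P_lin// /Q char_integral_lincomb//.
    rewrite opprD addrACA -mulrBr; apply: le_trans (Re_normD _ _) _.
    by rewrite Re_normM lerD2r /= expr0n addr0 sqrtr_sqr.
  apply: le_trans (Re_normD _ _) _; rewrite normrN mulrDl lerD//; last exact: char_integral_le.
  apply: (@le_trans _ _ (M * Rintegral mu setT (fun x => `|g x|))); last first.
    by rewrite ler_wpM2r ?ler_norm// Rintegral_ge0.
  rewrite -lecR -normCE rmorphM /= -(norm_toL1_real gi).
  exact: le_trans (Cbnorm_ub _ _) (TM _).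
have p_shift (x : G) (g : G -> R) : mu.-integrable setT (EFin \o g) ->
    p (fun t => g (t - x)) <= p g.
  (* A translation multiplies both [P g] and [Q g] by the conjugate of [chi x], which has modulus
     1. *)
  move=> gi; rewrite /p /Q char_integral_shift// /P toL1_real_shift// time_shift.
  rewrite -mulrBr Re_normM; have := char_norm chi x; case: (chi x) => u v /=.
  by move=> [+]; rewrite sqrrN => ->; rewrite mul1r.
have p_dirac (U : set G) (e : R) : open_nbhs 0 U -> 0 < e ->
    exists d : G -> R, [/\ continuous d, compact (closure [set x | d x != 0]),
      closure [set x | d x != 0] `<=` U, forall x, 0 <= d x &
      forall x, d (- x) = d x] /\
    [/\ mu.-integrable setT (EFin \o d), Rintegral mu setT d = 1 & p d <= e].
  move=> [oU U0] e0; have e3 : 0 < e / 3 by rewrite divr_gt0.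
  have [U1 [oU1 U10] U1P] := deltalim chi _ e3.
  have [U2 [oU2 U20] U2P] := nbhs_char_near1 chi e3.
  (* [U] prescribes the support, [U1] makes [T] close to 1 on the Dirac function of [V], and [U2]
     keeps [chi] close to 1 on its support. *)
  pose V := U `&` U1 `&` U2.
  have V0 : open_nbhs 0 V by split => //; apply: openI => //; exact: openI.
  have [cd cs sV d0 dN d1] := deltaP V V0.
  pose d x := complex.Re (delta V x).
  have dE x : delta V x = (d x)%:C.
    by apply/esym/RRe_real; exact: ger0_real.
  have d_ge0 x : 0 <= d x by have := d0 x; rewrite dE lecR.
  have suppE : [set x | d x != 0] = [set x | delta V x != 0].
    by apply/seteqP; split => x /=; rewrite dE fmorph_eq0.
  have [di _] := Cc_cintegrable haar_mu cd cs.
  have int1 : Rintegral mu setT d = 1.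
    by have := congr1 (@complex.Re R) d1.
  exists d; split; split => //.
  - by move=> x; apply: continuous_comp; [exact: cd|exact: Re_continuous].
  - by rewrite suppE.
  - by rewrite suppE => x /sV[[]].
  - by move=> x; rewrite /d dN.
  (* Both [P d] and [Q d] are compared with 1: one third of [e] is spent on the Dirac property, two
     thirds on the two parts of the Fourier integral. *)
  have -> : e = e / 3 + 2 * (e / 3) by field.
  have dchi : complex.Re `|Q d - 1| <= 2 * (e / 3).
    apply: char_integral_dirac => // x dx; apply: U2P.
    have /sV[] // : csupport (delta V) x.
    by apply: subset_closure; rewrite /= dE fmorph_eq0.
  have dT : complex.Re `|P d - 1| <= e / 3.
    rewrite -lecR -normCE /P; apply/ltW.
    rewrite (_ : (fun x => (d x)%:C) = delta V); last by apply/funext => x; rewrite dE.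
    by apply: U1P => // x [[]].
  rewrite /p -[P d](subrK 1) -addrA; apply: le_trans (Re_normD _ _) _.
  by rewrite lerD// distrC.
have pE g : mu.-integrable setT (EFin \o g) -> P g = Q g.
  move=> gi; apply/eqP; rewrite -subr_eq0; apply/eqP/Re_norm_eq0.
  apply: (L1_seminorm_vanishes hausdorffG haar_mu p_semi p_shift _ p_dirac gi).
  by rewrite addr_ge0.
have [fr fi] := L1_cintegrable f.
(* Both sides are complex linear, so agreement on the real and imaginary parts of [f] suffices. *)
rewrite (cintegral_char chi (L1_cintegrable f)) -/(Q _) -/(Q _) -!pE//.
by rewrite {1}(L1_real_im f) linearD linearZ.
Qed.
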